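(* Let $\mathbf{u}_1,\mathbf{u}_2$ be two quasi-definite linear functionals on polynomials, taking real values on real polynomials, let $(P_n)_{n\ge0}$ be the sequence of monic orthogonal polynomials with respect to $\mathbf{u}_1$, and assume $\langle\mathbf{u}_2,P_n\rangle\ne0$ for all $n\ge0$. Let $$V_n(x)=P_n(x)+\delta_nP_{n-1}(x),\qquad\delta_n=-\frac{\langle\mathbf{u}_2,P_n\rangle}{\langle\mathbf{u}_2,P_{n-1}\rangle},\quad n\ge1,$$ so that $\langle\mathbf{u}_2,V_n\rangle=0$ for $n\ge1$. Then $$(x-\Gamma_n)P_n(x)=V_{n+1}(x)+A_nV_n(x),\qquad n\ge0,$$ where $$\Gamma_n=\frac{\langle\mathbf{u}_2,xP_n\rangle}{\langle\mathbf{u}_2,P_n\rangle},\qquad A_0=0,\qquad A_k=\frac{\langle\mathbf{u}_1,xP_kP_{k-1}\rangle}{\delta_k\langle\mathbf{u}_1,P_{k-1}^2\rangle},\quad k=1,2,\dots$$ (for $n=0$ the term $A_0V_0$ is understood as $0$).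
   Context: A linear functional $\mathbf{u}$ on polynomials is quasi-definite if there is a sequence of monic polynomials $(P_n)_{n\ge0}$ with $\deg P_n=n$ and $\langle\mathbf{u},P_nP_k\rangle=K_n\delta_{n,k}$, $K_n\neq0$ for all $n$; this sequence is the sequence of monic orthogonal polynomials with respect to $\mathbf{u}$. *)

(* Defs.v *)
From mathcomp Require Import all_boot all_order all_algebra.

Set Implicit Arguments.
Unset Strict Implicit.
Unset Printing Implicit Defensive.

Import Order.TTheory GRing.Theory Num.Theory.
Local Open Scope ring_scope.

(* The coefficient field is an arbitrary [numFieldType], so that functionals
   on real polynomials and on complex polynomials are both covered.  When F is
   a field of real numbers, [real_functional] holds trivially; when F is a
   field of complex numbers, [Num.real] is its subfield of real numbers. *)

Definition real_functional (F : numFieldType) (u : {scalar {poly F}}) : Prop :=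
  forall p : {poly F}, p \is a polyOver Num.real -> u p \is Num.real.

Definition monic_orthogonal (F : numFieldType) (u : {scalar {poly F}})
    (P : nat -> {poly F}) : Prop :=
  (forall n, P n \is monic /\ size (P n) = n.+1) /\
  exists K : nat -> F,
    (forall n, K n != 0) /\
    (forall n k, u (P n * P k) = K n * (n == k)%:R).

Definition quasi_definite (F : numFieldType) (u : {scalar {poly F}}) : Prop :=
  exists P : nat -> {poly F}, monic_orthogonal u P.

(* [delta] and [Vpoly] are only meaningful for n >= 1; at n = 0 the index
   n.-1 is 0, and the resulting values carry no mathematical content. *)
Definition delta (F : numFieldType) (u2 : {scalar {poly F}})
    (P : nat -> {poly F}) (n : nat) : F :=
  - (u2 (P n) / u2 (P n.-1)).

Definition Vpoly (F : numFieldType) (u2 : {scalar {poly F}})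
    (P : nat -> {poly F}) (n : nat) : {poly F} :=
  P n + delta u2 P n *: P n.-1.

Definition Gamma (F : numFieldType) (u2 : {scalar {poly F}})
    (P : nat -> {poly F}) (n : nat) : F :=
  u2 ('X * P n) / u2 (P n).

Definition Acoef (F : numFieldType) (u1 u2 : {scalar {poly F}})
    (P : nat -> {poly F}) (n : nat) : F :=
  if n is k.+1 then
    u1 ('X * P k.+1 * P k) / (delta u2 P k.+1 * u1 (P k ^+ 2))
  else 0.

(* Main.v *)
(* Applying u1, [x * P n] has no component on [P k] for k < n - 1, and its
   components on [P n.+1] and [P n.-1] agree with those of
   [V n.+1 + A n *: V n].  Hence the two sides of the identity differ by a
   multiple of [P n]; both are annihilated by u2, which does not annihilate
   [P n], so this multiple is zero. *)

Require Import Defs.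
From mathcomp Require Import all_boot all_order all_algebra.
From mathcomp Require Import ring.

Set Implicit Arguments.
Unset Strict Implicit.
Unset Printing Implicit Defensive.

Import Order.TTheory GRing.Theory Num.Theory.
Local Open Scope ring_scope.

Section MonicOrthogonal.

Variables (F : numFieldType) (u : {scalar {poly F}}) (P : nat -> {poly F}).
Hypothesis orthP : monic_orthogonal u P.

Lemma monic_orth_size n : size (P n) = n.+1.
Proof. by have [/(_ n)[]] := orthP. Qed.

Lemma monic_orth_coef n : (P n)`_n = 1.
Proof.
have [/(_ n)[/monicP + sPn] _] := orthP.
by rewrite /lead_coef sPn.
Qed.

Lemma monic_orth_eq0 n k : n != k -> u (P n * P k) = 0.
Proof.
by have [_ [K [_ ->]]] := orthP => /negbTE ->; rewrite mulr0.
Qed.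

Lemma monic_orth_neq0 n : u (P n * P n) != 0.
Proof. by have [_ [K [K_neq0 ->]]] := orthP; rewrite eqxx mulr1. Qed.

Lemma size_monic_orth_sub n (p : {poly F}) :
  (size p <= n.+1)%N -> (size (p - p`_n *: P n)%R <= n)%N.
Proof.
move=> sp; apply/leq_sizeP => j; rewrite leq_eqVlt => /predU1P[<-|nj].
  by rewrite coefB coefZ monic_orth_coef mulr1 subrr.
rewrite coefB coefZ [(P n)`_j]nth_default ?monic_orth_size //.
by rewrite mulr0 subr0 nth_default // (leq_trans sp nj).
Qed.

Lemma monic_orth_low n (p : {poly F}) : (size p <= n)%N -> u (p * P n) = 0.
Proof.
(* The size bound [m] is decoupled from [n], so that induction can peel off the top multiple of
   [P m] while [P n] stays fixed. *)
suff low m (q : {poly F}) : (size q <= m)%N -> (m <= n)%N -> u (q * P n) = 0.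
  by move=> /low; apply.
elim: m q => [|m IHm] q sq mn.
  by rewrite (size_poly_leq0P _ sq) mul0r linear0.
rewrite -[q](subrK (q`_m *: P m)) mulrDl linearD /=.
rewrite IHm ?size_monic_orth_sub ?(ltnW mn) // add0r.
by rewrite -scalerAl linearZ /= monic_orth_eq0 ?mulr0 // neq_ltn mn.
Qed.

(** Pairing [p] with the [P k] of highest index sees only the top coefficient of [p], multiplied by
    the nonzero [u (P k * P k)]; that coefficient vanishes, the size drops, and one descends. *)
Lemma monic_orth_poly0 n (p : {poly F}) :
  (size p <= n)%N -> (forall k, (k < n)%N -> u (p * P k) = 0) -> p = 0.
Proof.
elim: n => [|n IHn] sp up0; first exact/size_poly_leq0P.
have sr := size_monic_orth_sub sp.
have pn0 : p`_n = 0.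
  have := up0 n (leqnn _).
  rewrite -{1}[p](subrK (p`_n *: P n)) mulrDl linearD /= monic_orth_low //.
  rewrite add0r -scalerAl linearZ /= => /eqP.
  by rewrite mulf_eq0 (negbTE (monic_orth_neq0 n)) orbF => /eqP.
apply: IHn => [|k kn]; last exact: up0 (ltnW kn).
by rewrite pn0 scale0r subr0 in sr.
Qed.

Lemma monic_orth_three_term n : exists b : F,
  'X * P n = P n.+1 + b *: P n
    + (if n is k.+1 then (u ('X * P k.+1 * P k) / u (P k ^+ 2)) *: P k else 0).
Proof.
set t := if n is _.+1 then _ else _.
have st : (size t <= n)%N.
  rewrite /t; case: (n) => [|k]; first by rewrite size_poly0.
  by rewrite (leq_trans (size_scale_leq _ _)) ?monic_orth_size.
have sXP : (size ('X * P n)%R <= n.+2)%N.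
  by rewrite mulrC (leq_trans (size_polyMleq _ _)) // size_polyX monic_orth_size addn2.
have lXP : ('X * P n)`_n.+1 = 1 by rewrite coefXM monic_orth_coef.
pose q := 'X * P n - P n.+1 - t.
have sq : (size q <= n.+1)%N.
  rewrite (leq_trans (size_polyD _ _)) // size_polyN geq_max (leqW st) andbT.
  by have := size_monic_orth_sub sXP; rewrite lXP scale1r.
exists q`_n; suff /eqP : q - q`_n *: P n = 0.
  by rewrite subr_eq0 /q => /eqP <-; ring.
apply: (@monic_orth_poly0 n) => [|k kn]; first exact: size_monic_orth_sub.
rewrite !mulrBl !linearB /= -scalerAl linearZ /=.
rewrite !(@monic_orth_eq0 _ k) ?mulr0 ?subr0; last 2 first.
- by rewrite neq_ltn kn orbT.
- by rewrite neq_ltn (leqW kn : (k < n.+1)%N) orbT.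
rewrite /t; case: (n) kn => // m.
rewrite ltnS leq_eqVlt -scalerAl linearZ /= => /predU1P[->|km].
  by rewrite -expr2 divfK ?subrr // expr2 monic_orth_neq0.
rewrite (@monic_orth_eq0 m k) ?mulr0 ?subr0; last by rewrite neq_ltn km orbT.
(* Multiplication by ['X] moves onto [P k], giving size [k + 2], at most [m + 1]: too small to pair
   with [P m.+1]. *)
have -> : 'X * P m.+1 * P k = 'X * P k * P m.+1 by ring.
apply: monic_orth_low.
rewrite mulrC (leq_trans (size_polyMleq _ _)) // size_polyX monic_orth_size addn2.
exact: km.
Qed.

End MonicOrthogonal.

Lemma Vpoly_eq0 (F : numFieldType) (u : {scalar {poly F}})
    (P : nat -> {poly F}) n :
  u (P n) != 0 -> u (Vpoly u P n.+1) = 0.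
Proof.
by move=> un0; rewrite /Vpoly /delta linearD linearZ /= mulNr divfK ?subrr.
Qed.

Theorem proposition4p3 (F : numFieldType) (u1 u2 : {scalar {poly F}})
    (P : nat -> {poly F})
    (real_u1 : real_functional u1) (real_u2 : real_functional u2)
    (qd_u1 : quasi_definite u1) (qd_u2 : quasi_definite u2)
    (orthP : monic_orthogonal u1 P)
    (u2P_neq0 : forall n : nat, u2 (P n) != 0) :
  (forall n : nat, (1 <= n)%N -> u2 (Vpoly u2 P n) = 0) /\
  (forall n : nat,
     ('X - (Gamma u2 P n)%:P) * P n
     = Vpoly u2 P n.+1 + Acoef u1 u2 P n *: Vpoly u2 P n).
Proof.
split=> [[//|n] _|n]; first exact: Vpoly_eq0.
set lhs := LHS; set rhs := RHS.
have u2l : u2 lhs = 0.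
  by rewrite /lhs /Gamma mulrBl linearB mul_polyC linearZ /= divfK ?subrr.
have u2r : u2 rhs = 0.
  rewrite /rhs linearD linearZ /= Vpoly_eq0 // add0r.
  (* At index 0 the factor [Acoef] is zero, so the conventional value of [Vpoly] there does not
     matter. *)
  by case: (n) => [|m] /=; rewrite ?mul0r // Vpoly_eq0 ?mulr0.
suff [e lr] : exists e, lhs - rhs = e *: P n.
  have /eqP : u2 (e *: P n) = 0 by rewrite -lr linearB /= u2l u2r subrr.
  rewrite linearZ /= mulf_eq0 (negbTE (u2P_neq0 n)) orbF => /eqP e0.
  by apply/eqP; rewrite -subr_eq0 lr e0 scale0r.
have [b XP] := monic_orth_three_term orthP n.
(* Coefficient of [P n] on the left, [b - Gamma], minus its contributions from [Vpoly] at [n.+1] and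
   at [n]. *)
exists (b - Gamma u2 P n - delta u2 P n.+1 - Acoef u1 u2 P n).
rewrite /lhs /rhs mulrBl XP mul_polyC /Vpoly /=.
case: n {lhs rhs u2l u2r XP} => [|m] /=.
  by rewrite scale0r -!mul_polyC; ring.
have d0 : delta u2 P m.+1 != 0.
  by rewrite /delta oppr_eq0 mulf_neq0 ?invr_eq0.
set c := _ / u1 _; set A := _ / _.
(* [Acoef] is the three-term coefficient of [P m] divided by [delta], so the components on [P m]
   cancel. *)
have -> : c = A * delta u2 P m.+1.
  by rewrite /A /c invfM [_^-1 * _^-1]mulrC mulrA divfK.
by rewrite -!mul_polyC !(rmorphB, rmorphM) /=; ring.
Qed.
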